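(* Let $G^{\mathcal{L}}=(V\cup\mathcal{L},D)$ be a latent-factor graph, let $v\in V$, and suppose that the triple $(Y,Z,H)\in 2^{V\setminus\{v\}}\times 2^{V\setminus\{v\}}\times 2^{\mathcal{L}}$ satisfies the latent-factor half-trek criterion (LF-HTC) with respect to $v$. If all directed edges $u\to y\in D_V$ with head $y\in Z\cup\big(Y\cap \mathrm{htr}_H(Z\cup\{v\})\big)$ are rationally identifiable, then all directed edges in $D_V$ with $v$ as a head are rationally identifiable.
   Context: **Latent-factor graphs.** $V$ and $\mathcal{L}$ are disjoint finite sets (observed and latent nodes), $d=|V|$, $\ell=|\mathcal{L}|$. A latent-factor graph $G^{\mathcal{L}}=(V\cup\mathcal{L},D)$ is a directed graph without self-loops, possibly with directed cycles, in which no latent node has a parent (so every edge out of a latent node points to an observed node). Write $D_V=D\cap(V\times V)$ and $D_{\mathcal{L}V}=D\cap(\mathcal{L}\times V)$, so $D=D_V\cup D_{\mathcal{L}V}$. For an edge $u\to y$ the node $y$ is its head. For $v\in V$, $\mathrm{pa}_V(v)=\{w\in V: w\to v\in D_V\}$ and $\mathrm{pa}_{\mathcal{L}}(v)=\{h\in\mathcal{L}: h\to v\in D_{\mathcal{L}V}\}$; for a set $U\subseteq V$, $\mathrm{pa}_{\mathcal{L}}(U)=\bigcup_{u\in U}\mathrm{pa}_{\mathcal{L}}(u)$. **Model.** $\mathbb{R}^{D_V}$ is the set of real $d\times d$ matrices $\Lambda=(\lambda_{wv})$ with $\lambda_{wv}=0$ if $w\to v\notin D_V$; $\mathbb{R}^{D_V}_{\mathrm{reg}}$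 is the subset of those with $I_d-\Lambda$ invertible. $\mathbb{R}^{D_{\mathcal{L}V}}$ is the set of real $\ell\times d$ matrices $\Gamma=(\gamma_{hv})$ with $\gamma_{hv}=0$ if $h\to v\notin D_{\mathcal{L}V}$. $\mathrm{diag}^+_d$ is the set of $d\times d$ diagonal matrices with positive diagonal, and $\mathit{PD}(d)$ the cone of positive definite symmetric $d\times d$ matrices. Let $\tau:\mathbb{R}^{D_{\mathcal{L}V}}\times\mathrm{diag}^+_d\to\mathit{PD}(d)$, $\tau(\Gamma,\Omega_{\mathsf{diag}})=\Omega_{\mathsf{diag}}+\Gamma^\top\Gamma$, let $\Theta=\mathbb{R}^{D_V}_{\mathrm{reg}}\times\mathrm{Im}(\tau)$, and let $\varphi_{G^{\mathcal{L}}}:\Theta\to\mathit{PD}(d)$, $\varphi_{G^{\mathcal{L}}}(\Lambda,\Omega)=(I_d-\Lambda)^{-\top}\Omega(I_d-\Lambda)^{-1}$. $\overline{\Theta}$ denotes the Zariski closure of $\Theta$ (it is irreducible). **Rational identifiability of an edge.** The edge $v\to w\in D_V$ is rationally identifiable if there exist a proper algebraic subset $A\subset\overline{\Theta}$ and a rational map $\psi:\mathit{PD}(d)\to\mathbb{R}$ (a quotient of polynomials in the matrix entries) such that $\psi\circ\varphi_{G^{\mathcal{L}}}(\Lambda,\Omega)=\lambda_{vw}$ for all $(\Lambda,\Omega)\in\Theta\setminus A$ (in particular $\psi$ is defined at these points). **Latent-factor half-treks.** A latent-factor half-trek from source $v\in V$ to target $w\in V$ is a path in $G^{\mathcal{L}}$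 of the form $v\to x_1\to\dots\to x_n\to w$ or of the form $v\leftarrow h\to x_1\to\dots\to x_n\to w$, with $x_1,\dots,x_n\in V$ ($n\ge 0$) and $h\in\mathcal{L}$. For $\pi$ of the first form, $\mathrm{Left}(\pi)=\{v\}$ and $\mathrm{Right}(\pi)=\{v,x_1,\dots,x_n,w\}$; for the second form, $\mathrm{Left}(\pi)=\{v,h\}$ and $\mathrm{Right}(\pi)=\{h,x_1,\dots,x_n,w\}$. A half-trek from $v$ to $v$ may have no edges (trivial half-trek), in which case $\mathrm{Left}(\pi)=\mathrm{Right}(\pi)=\{v\}$. A set $\Pi=\{\pi_1,\dots,\pi_n\}$ of latent-factor half-treks with pairwise distinct sources $v_1,\dots,v_n$ and pairwise distinct targets $w_1,\dots,w_n$ is a system of latent-factor half-treks from $\{v_1,\dots,v_n\}$ to $\{w_1,\dots,w_n\}$. It has no sided intersection if $\mathrm{Left}(\pi_i)\cap\mathrm{Left}(\pi_j)=\emptyset=\mathrm{Right}(\pi_i)\cap\mathrm{Right}(\pi_j)$ for all $i\ne j$. **Half-trek reachability.** For distinct $v,w\in V$ and $H\subseteq\mathcal{L}$, write $w\in\mathrm{htr}_H(v)$ if there is a latent-factor half-trek from $v$ to $w$ that does not pass through any node in $H$. For $U\subseteq V$, $w\in\mathrm{htr}_H(U)$ if $w\in\mathrm{htr}_H(u)$ for some $u\in U$. **LF-HTC.** Given $v\in V$, a triple $(Y,Z,H)\in 2^{V\setminus\{v\}}\times2^{V\setminus\{v\}}\times2^{\mathcal{L}}$ satisfies the latent-factor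 half-trek criterion with respect to $v$ if (i) $|Y|=|\mathrm{pa}_V(v)|+|H|$ and $|Z|=|H|$ with $Z\cap\mathrm{pa}_V(v)=\emptyset$; (ii) $Y\cap(Z\cup\{v\})=\emptyset$ and $\mathrm{pa}_{\mathcal{L}}(Y)\cap\mathrm{pa}_{\mathcal{L}}(Z\cup\{v\})\subseteq H$; and (iii) there exists a system of latent-factor half-treks with no sided intersection from $Y$ to $Z\cup\mathrm{pa}_V(v)$ in $G^{\mathcal{L}}$ such that for each $z\in Z$, the half-trek terminating at $z$ takes the form $y\leftarrow h\to z$ for some $y\in Y$ and some $h\in H$. *)

(* Defs.v *)
From HB Require Import structures.
From mathcomp Require Import all_boot all_order all_algebra.
From mathcomp Require Import reals mpoly.

Set Implicit Arguments.
Unset Strict Implicit.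
Unset Printing Implicit Defensive.

Import GRing.Theory Num.Theory.

Local Open Scope ring_scope.

Record lf_graph (V L : finType) := LFGraph {
  edge : rel (V + L);
  edge_irr : irreflexive edge;
  edge_latent : forall x h, ~~ edge x (inr h) }.

Section Graph.
Variables (V L : finType) (G : lf_graph V L).

Definition obs_edge (v w : V) : bool := edge G (inl v) (inl w).
Definition lat_edge (h : L) (v : V) : bool := edge G (inr h) (inl v).

Definition paV (v : V) : {set V} := [set w | obs_edge w v].
Definition paL (v : V) : {set L} := [set h | lat_edge h v].
Definition paLs (U : {set V}) : {set L} := \bigcup_(u in U) paL u.

(* [Directed v p] is the path v -> p_1 -> ... -> p_k, which is the trivial
   half-trek when p is empty; [Latent v h x p] is the path
   v <- h -> x -> p_1 -> ... -> p_k.  Nodes may be repeated along a path. *)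
Inductive halftrek :=
  | Directed of V & seq V
  | Latent of V & L & V & seq V.

Definition is_halftrek (t : halftrek) : bool :=
  match t with
  | Directed v p => path obs_edge v p
  | Latent v h x p => [&& lat_edge h v, lat_edge h x & path obs_edge x p]
  end.

Definition source (t : halftrek) : V :=
  match t with Directed v _ => v | Latent v _ _ _ => v end.

Definition target (t : halftrek) : V :=
  match t with Directed v p => last v p | Latent _ _ x p => last x p end.

Definition lefts (t : halftrek) : seq (V + L) :=
  match t with
  | Directed v _ => [:: inl v]
  | Latent v h _ _ => [:: inl v; inr h]
  end.

Definition rights (t : halftrek) : seq (V + L) :=
  match t with
  | Directed v p => [seq inl x | x <- v :: p]
  | Latent _ h x p => inr h :: [seq inl y | y <- x :: p]
  end.

Definition nodes (t : halftrek) : seq (V + L) := lefts t ++ rights t.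

Definition is_system (n : nat) (t : 'I_n -> halftrek) (A B : {set V}) : Prop :=
  [/\ forall i, is_halftrek (t i),
      injective (source \o t),
      injective (target \o t),
      [set source (t i) | i : 'I_n] = A
    & [set target (t i) | i : 'I_n] = B].

Definition no_sided_intersection (n : nat) (t : 'I_n -> halftrek) : Prop :=
  forall i j, i != j ->
    [disjoint lefts (t i) & lefts (t j)] /\
    [disjoint rights (t i) & rights (t j)].

Definition htr (H : {set L}) (v w : V) : Prop :=
  v != w /\
  exists t, [/\ is_halftrek t, source t = v, target t = w
              & forall h, h \in H -> inr h \notin nodes t].

Definition htrs (H : {set L}) (U : {set V}) (w : V) : Prop :=
  exists2 u, u \in U & htr H u w.

Definition lf_htc (v : V) (Y Z : {set V}) (H : {set L}) : Prop :=
  [/\ [/\ #|Y| = (#|paV v| + #|H|)%N, #|Z| = #|H| & [disjoint Z & paV v]],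
      [disjoint Y & v |: Z] /\ paLs Y :&: paLs (v |: Z) \subset H
    & exists (n : nat) (t : 'I_n -> halftrek),
        [/\ is_system t Y (Z :|: paV v),
            no_sided_intersection t
          & forall i, target (t i) \in Z ->
              exists y h, [/\ y \in Y, h \in H
                            & t i = Latent y h (target (t i)) [::]]]].

End Graph.

Section Model.
Variables (R : realType) (V L : finType) (G : lf_graph V L).

(* Matrices with rows and columns labelled by V or L are indexed through the
   canonical enumerations of these types. *)
Local Notation d := #|V|.
Local Notation l := #|L|.

Definition RDV (Lam : 'M[R]_d) : Prop :=
  forall w v : V, ~~ obs_edge G w v -> Lam (enum_rank w) (enum_rank v) = 0.

Definition RDV_reg (Lam : 'M[R]_d) : Prop :=
  RDV Lam /\ 1%:M - Lam \in unitmx.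

Definition RDLV (Gam : 'M[R]_(l, d)) : Prop :=
  forall (h : L) (v : V),
    ~~ lat_edge G h v -> Gam (enum_rank h) (enum_rank v) = 0.

Definition diag_pos (W : 'M[R]_d) : Prop :=
  is_diag_mx W /\ forall i, 0 < W i i.

Definition tau (Gam : 'M[R]_(l, d)) (W : 'M[R]_d) : 'M[R]_d :=
  W + Gam^T *m Gam.

Definition im_tau (Om : 'M[R]_d) : Prop :=
  exists Gam W, [/\ RDLV Gam, diag_pos W & Om = tau Gam W].

Definition Theta (x : 'M[R]_d * 'M[R]_d) : Prop :=
  RDV_reg x.1 /\ im_tau x.2.

Definition phi (x : 'M[R]_d * 'M[R]_d) : 'M[R]_d :=
  (invmx (1%:M - x.1))^T *m x.2 *m invmx (1%:M - x.1).

(* Polynomials in the entries of a d x d matrix, and of a pair of them. *)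
Definition eval1 (p : {mpoly R[(d * d)%N]}) (S : 'M[R]_d) : R :=
  p.@[fun k => mxvec S 0 k].

Definition eval2 (p : {mpoly R[(d * d + d * d)%N]}) (x : 'M[R]_d * 'M[R]_d) : R :=
  p.@[fun k => row_mx (mxvec x.1) (mxvec x.2) 0 k].

Definition zeros (I : {mpoly R[(d * d + d * d)%N]} -> Prop)
    (x : 'M[R]_d * 'M[R]_d) : Prop :=
  forall p, I p -> eval2 p x = 0.

Definition algebraic (A : 'M[R]_d * 'M[R]_d -> Prop) : Prop :=
  exists I, forall x, A x <-> zeros I x.

Definition zclosure (A : 'M[R]_d * 'M[R]_d -> Prop) :
    'M[R]_d * 'M[R]_d -> Prop :=
  zeros (fun p => forall x, A x -> eval2 p x = 0).

Definition proper_algebraic_subset (A B : 'M[R]_d * 'M[R]_d -> Prop) : Prop :=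
  [/\ algebraic A, forall x, A x -> B x & exists2 x, B x & ~ A x].

(* The rational map is p / q.  Since Theta minus A is never empty, q is not
   identically zero on the positive definite cone. *)
Definition rationally_identifiable (v w : V) : Prop :=
  exists A, proper_algebraic_subset A (zclosure Theta) /\
  exists p q : {mpoly R[(d * d)%N]}, forall x, Theta x -> ~ A x ->
    eval1 q (phi x) != 0 /\
    eval1 p (phi x) / eval1 q (phi x) = x.1 (enum_rank v) (enum_rank w).

End Model.

(* Main.v *)
Require Import Defs.
From mathcomp Require Import boolp.
From HB Require Import structures.
From mathcomp Require Import all_boot all_order all_algebra.
From mathcomp Require Import reals mpoly.

(** Write T = (I - Lam)^-1 and S = T^T Om T.  Let y be in Y and let e be e_y if
    y lies in htr_H(Z + v), and T e_y otherwise.  The second condition of the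
    criterion says that y shares no latent parent outside H with Z + v; when y
    is not reachable, neither does any ancestor of y.  Hence e^T Om agrees on
    the columns in Z + v with a combination of the rows of Gam indexed by H
    ([row_factor_Om]).  If the block Gam_{H,Z} is invertible, its column v is
    a combination psi of its columns in Z, so the same psi satisfies
      (e^T Om)_v = (e^T Om)_Z psi   for all y in Y.
    Since e^T Om = e^T Om T (I - Lam), these are |Y| linear equations in the
    |pa(v)| + |Z| = |Y| unknowns (lambda_{pa(v),v}, psi) ([linear_system]).
    Their coefficients involve only S and the columns of Lam that are assumed
    identifiable, because e^T Om T is a row of (I - Lam)^T S or of S.  By
    Cramer's rule the unknowns are rational in S wherever the coefficient
    matrix M is invertible ([identifiable_target]); invertibility of M also
    forces that of Gam_{H,Z} ([latent_solution]).

    Rational identifiability of a function on Theta is shown to be stable under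
    sums, products and division by a regular function, not identically zero
    ([identifiable_algebra], [identifiable_div]).  This rests on the
    irreducibility of Theta ([Theta_irreducible]): two points of Theta are
    joined by a segment of parameters, along which polynomials restrict to
    polynomials in one variable.

    It remains to find one point of Theta where M is invertible
    ([coefficients_x0_unit]).  Among all systems of half-treks as in the third
    condition, with simple right-hand paths, one of minimal size has the
    property that the relation [tangled], saying that the source of t_i lies on
    the right-hand path of t_m (unless t_i is directed and i = m), has no
    cycles: half-treks along a cycle could be rerouted along the tails of each
    other's paths ([reroute]).  Give weight 1 to the edges of this
    system, weight 0 to the others, and take the identity as the diagonal part.
    Then M has nonnegative entries and a positive diagonal, and M_ij <> 0 with
    i <> j implies that i is below j in the relation above, or that the sources
    of i and j lie on one path with that of j coming first
    ([entry_key]).  These conditions order the indices so that M is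
    triangular. *)

Set Implicit Arguments.
Unset Strict Implicit.
Unset Printing Implicit Defensive.
Import Order.TTheory GRing.Theory Num.Theory.

(** * Systems of half-treks without cyclic entanglement *)

Definition depth (T : finType) (e : rel T) i := #|[set k | connect e i k]|.

Lemma depth_lt (T : finType) (e : rel T) i m :
  e i m -> ~~ connect e m i -> depth e m < depth e i.
Proof.
move=> im mi; apply/proper_card/properP; split.
  by apply/subsetP => k; rewrite !inE; apply/connect_trans/connect1.
by exists i; rewrite !inE ?connect0.
Qed.

Section Systems.
Variables (V L : finType) (G : lf_graph V L).
Implicit Types x : V.

(** The observed nodes on the right-hand side of a half-trek, in order. *)
Definition right_path (t : halftrek V L) : seq V :=
  match t with Directed v p => v :: p | Latent _ _ x p => x :: p end.

Definition latent (t : halftrek V L) : option L :=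
  match t with Directed _ _ => None | Latent _ h _ _ => Some h end.

Definition start (t : halftrek V L) : V :=
  match t with Directed v _ => v | Latent _ _ x _ => x end.

Lemma mem_rightsV (t : halftrek V L) x :
  (inl x \in rights t) = (x \in right_path t).
Proof.
case: t => [v p|v h y p] /=; rewrite ?[in LHS]inE -?map_cons mem_map //;
by move=> ? ? [].
Qed.

Lemma mem_rightsL (t : halftrek V L) h :
  (inr h \in rights t) = (latent t == Some h).
Proof.
have F (s : seq V) : (inr h \in ([seq inl z | z <- s] : seq (V + L))) = false.
  by apply/mapP => -[].
by case: t => [v p|v k y p] /=; rewrite !inE F ?orbF //= [RHS]eq_sym.
Qed.

Lemma sorted_right_path (t : halftrek V L) :
  is_halftrek G t -> sorted (obs_edge G) (right_path t).
Proof. by case: t => //= v h x p /and3P[]. Qed.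

Lemma target_right_path (t : halftrek V L) x : target t = last x (right_path t).
Proof. by case: t. Qed.

Lemma start_right_path (t : halftrek V L) : start t \in right_path t.
Proof. by case: t => *; rewrite mem_head. Qed.

Lemma index_start (t : halftrek V L) : index (start t) (right_path t) = 0%N.
Proof. by case: t => * /=; rewrite eqxx. Qed.

Lemma target_mem (t : halftrek V L) : target t \in right_path t.
Proof. by case: t => [v p|v h x p] /=; rewrite mem_last. Qed.

Lemma start_directed (t : halftrek V L) : latent t = None -> start t = source t.
Proof. by case: t. Qed.

Lemma latent_edges (t : halftrek V L) h : is_halftrek G t -> latent t = Some h ->
  lat_edge G h (source t) /\ lat_edge G h (start t).
Proof. by case: t => //= v k x p /and3P[? ? _] [<-]. Qed.

Lemma size_rights (t : halftrek V L) :
  size (rights t) = (size (right_path t) + isSome (latent t))%N.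
Proof. by case: t => [v p|v h x p] /=; rewrite size_map ?addn0 ?addn1. Qed.

Section Admissible.
Variables (n : nat) (Y B Z : {set V}) (H : {set L}).
Hypothesis YZ : [disjoint Y & Z].

(** The third condition of the criterion, for targets B. *)
Record admissible (t : 'I_n -> halftrek V L) : Prop := Admissible {
  adm_system : is_system G t Y B;
  adm_sided : no_sided_intersection t;
  adm_Z : forall i, target (t i) \in Z -> exists y h,
    [/\ y \in Y, h \in H & t i = Latent y h (target (t i)) [::]] }.

(** A directed half-trek starts at its own source, so this coincidence of a
    half-trek with itself does not count. *)
Definition tangled (t : 'I_n -> halftrek V L) : rel 'I_n := fun i m =>
  (source (t i) \in right_path (t m)) && ((i != m) || isSome (latent (t m))).

Lemma right_path_inj (t : 'I_n -> halftrek V L) i j x : no_sided_intersection t ->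
  x \in right_path (t i) -> x \in right_path (t j) -> i = j :> 'I_n.
Proof.
move=> S xi xj; apply/eqP/negPn/negP => /S[_ /disjointFr/(_ _)].
by move/(_ (inl x)); rewrite !mem_rightsV xi xj => /(_ isT).
Qed.

Lemma latent_inj (t : 'I_n -> halftrek V L) i j h : no_sided_intersection t ->
  latent (t i) = Some h -> latent (t j) = Some h -> i = j :> 'I_n.
Proof.
move=> S xi xj; apply/eqP/negPn/negP => /S[_ /disjointFr/(_ _)].
by move/(_ (inr h)); rewrite !mem_rightsL xi xj eqxx => /(_ isT).
Qed.

Lemma admissible_simple (t : 'I_n -> halftrek V L) : admissible t ->
  exists2 t', admissible t' & forall i, uniq (right_path (t' i)).
Proof.
move=> [[tH tS tT tY tB] tN tZ].
pose sh (t : halftrek V L) := match t with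
  Directed v p => Directed _ v (shorten v p)
  | Latent v h x p => Latent v h x (shorten x p) end.
have shS i : source (sh (t i)) = source (t i) by case: (t i).
have shT i : target (sh (t i)) = target (t i).
  case: (t i) (tH i) => [v p|v h x p] /=; first by case/shortenP.
  by case/and3P => _ _; case/shortenP.
have shL i : lefts (sh (t i)) = lefts (t i) by case: (t i).
have shR i : {subset rights (sh (t i)) <= rights (t i)}.
  move=> [x|h]; rewrite ?mem_rightsV ?mem_rightsL; last by case: (t i).
  case: (t i) (tH i) => [v p|v k y p] /=; last case/and3P => _ _.
    by case/shortenP => q _ _ qp; rewrite !inE => /orP[->//|/qp->]; rewrite orbT.
  by case/shortenP => q _ _ qp; rewrite !inE => /orP[->//|/qp->]; rewrite orbT.
exists (sh \o t).
  split.
  - split => /=.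
    + move=> i; case: (t i) (tH i) => [v p|v h x p] /=; first by case/shortenP.
      by case/and3P => -> ->; case/shortenP.
    + by move=> i j /=; rewrite !shS; apply: tS.
    + by move=> i j /=; rewrite !shT; apply: tT.
    + by rewrite -tY; apply: eq_imset => i /=; rewrite shS.
    + by rewrite -tB; apply: eq_imset => i /=; rewrite shT.
  - move=> i j ij /=; rewrite !shL; have [tl tr] := tN i j ij; split=> //.
    exact: disjointW (introT subsetP (shR i)) (introT subsetP (shR j)) tr.
  - move=> i /=; rewrite shT => /tZ[y [h [yY hH ->]]].
    by exists y, h.
move=> i /=; case: (t i) (tH i) => [v p|v h x p] /=; first by case/shortenP.
by case/and3P => _ _; case/shortenP.
Qed.

Definition total_size (t : 'I_n -> halftrek V L) :=
  \sum_i size (rights (t i)).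

(** The right-hand paths are disjoint, so [tangled] is the graph of a partial
    function f, and a cycle is an orbit C of f.  Replacing the half-trek of each
    k in C by the directed tail, from the source of k on, of the path of f k
    permutes the targets and keeps the sides disjoint.  The system gets smaller
    because all half-treks met along C lose their latent node.  Targets in Z are
    not affected: their paths consist of one node of Z, which is no source. *)
Lemma reroute (t : 'I_n -> halftrek V L) i m :
  admissible t -> (forall i, uniq (right_path (t i))) ->
  tangled t i m -> connect (tangled t) m i ->
  exists t', [/\ admissible t', forall i, uniq (right_path (t' i))
    & total_size t' < total_size t].
Proof.
move=> [[tH tS tT tY tB] tN tZ] tU im mi.
pose f k := odflt k [pick m | tangled t k m].
have fE k l : tangled t k l -> f k = l.
  rewrite /f; case: pickP => [l' /andP[kl' _] /andP[kl _]|/(_ l)->] //=.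
  exact: right_path_inj kl' kl.
have fi : i \in fconnect f (f i).
  rewrite inE (fE _ _ im); apply: connect_sub mi => k l /fE <-.
  exact: fconnect1.
pose C := orbit f i.
have iC : i \in C by rewrite -fconnect_orbit.
have cC : fcycle f C by move/(orbitPcycle 2 0): fi.
have fI : {in C &, injective f} by move/(orbitPcycle 2 5): fi.
have fC k : k \in C -> f k \in C.
  by rewrite -!fconnect_orbit => /connect_trans -> //; apply: fconnect1.
(* Otherwise k is a fixed point of f, hence equals i, which has an image. *)
have tf k : k \in C -> tangled t k (f k).
  move=> kC; have := fconnect_cycle cC kC i; rewrite iC => /iter_findex ki.
  have := erefl (f k); rewrite {1}/f; case: pickP => [l kl /= <- //|no /= fk].
  have fix_k a : iter a f k = k by elim: a => //= a ->.
  by move: ki (no m); rewrite fix_k => ->; rewrite im.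
(* If f k were directed, its source would lie on its own path and thus on no
   other, so f k would not be tangled with any half-trek. *)
have Lf k : k \in C -> isSome (latent (t (f k))).
  move=> kC; case/andP: (tf _ (fC _ kC)) => s /orP[ne|]; last first.
    case E : (f (f k) == f k); first by rewrite (eqP E).
    move=> _; case e: (latent _) => //.
    move: (start_right_path (t (f k))); rewrite (start_directed e) => s'.
    by move: E; rewrite (right_path_inj tN s s') eqxx.
  case e: (latent _) => //.
  move: (start_right_path (t (f k))); rewrite (start_directed e) => s'.
  by move: ne; rewrite (right_path_inj tN s s') eqxx.
pose g k := if k \in C then f k else k.
have gI : injective g.
  move=> k l; rewrite /g; case: ifPn => kC; case: ifPn => lC // kl.
  - exact: fI.
  - by move: lC; rewrite -kl fC.
  - by move: kC; rewrite kl fC.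
pose R k := right_path (t (f k)).
pose y k := source (t k).
pose t' k := if k \in C then
  Directed L (y k) (drop (index (y k) (R k)).+1 (R k)) else t k.
have RE k : k \in C -> y k :: drop (index (y k) (R k)).+1 (R k) =
  drop (index (y k) (R k)) (R k).
  by move=> /tf /andP[yR _]; rewrite -drop_index.
have rE k : k \in C -> right_path (t' k) = drop (index (y k) (R k)) (R k).
  by move=> kC; rewrite /t' kC /= RE.
have t'S k : source (t' k) = source (t k) by rewrite /t'; case: ifP.
have t'T k : target (t' k) = target (t (g k)).
  rewrite /g; case: ifPn => kC; last by rewrite /t' (negPf kC).
  rewrite !(target_right_path _ (y k)) rE // -/(R k).
  rewrite -[in RHS](cat_take_drop (index (y k) (R k)) (R k)) last_cat.
  by rewrite -RE.
have t'L k : {subset lefts (t' k) <= lefts (t k)}.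
  move=> z; rewrite /t'; case: ifP => // _; rewrite /= inE /y.
  by case: (t k) => [??|????] /=; rewrite !inE // => ->.
have t'R k : {subset rights (t' k) <= rights (t (g k))}.
  rewrite /g; case: ifPn => kC z; last by rewrite /t' (negPf kC).
  case: z => [x|h]; rewrite ?mem_rightsV ?mem_rightsL; last by rewrite /t' kC.
  by rewrite rE //; apply: mem_drop.
exists t'; split; first split.
- split.
  + move=> k; rewrite /t'; case: ifPn => kC //=.
    have := sorted_right_path (tH (f k)); rewrite -/(R k).
    by move/(drop_sorted (index (y k) (R k))); rewrite -RE.
  + by move=> k l /=; rewrite !t'S; apply: tS.
  + by move=> k l /=; rewrite !t'T => /tT/gI.
  + by rewrite -tY; apply: eq_imset => k /=; rewrite t'S.
  + rewrite -tB; apply/setP => b; apply/imsetP/imsetP => -[k _ ->].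
      by exists (g k); rewrite ?t'T.
    have [g' _ gK] := injF_bij gI.
    by exists (g' k); rewrite // t'T gK.
- move=> k l kl; split.
    exact: disjointW (introT subsetP (t'L k)) (introT subsetP (t'L l))
      (tN k l kl).1.
  have gkl : g k != g l by apply: contra kl => /eqP/gI->.
  exact: disjointW (introT subsetP (t'R k)) (introT subsetP (t'R l))
    (tN _ _ gkl).2.
- move=> k; rewrite t'T => zZ; rewrite /t'; case: ifPn => kC; last first.
    by move: zZ; rewrite /g (negPf kC) => /tZ.
  move: zZ; rewrite /g kC => zZ; have [b [h [bY hH e]]] := tZ _ zZ.
  have /andP[] := tf _ kC; rewrite e /= inE => /eqP yz _.
  have : source (t k) \in Y by rewrite -tY imset_f.
  by move/(disjointFr YZ); rewrite yz zZ.
- move=> k; have [kC|kC] := boolP (k \in C); first by rewrite rE // drop_uniq /R.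
  by rewrite /t' (negPf kC).
rewrite /total_size [ltnRHS](reindex_inj gI) /= (bigD1 i) //= [ltnRHS](bigD1 i) //=.
have le k : k \in C -> size (rights (t' k)) < size (rights (t (g k))).
  move=> kC; rewrite !size_rights /g kC Lf // addn1 ltnS rE //.
  by rewrite /t' kC /= addn0 size_drop leq_subr.
rewrite -addSn.
apply: leq_add; first exact: le.
apply: leq_sum => k _.
by case: (boolP (k \in C)) => [/le/ltnW//|kC]; rewrite /t' /g (negPf kC).
Qed.

Lemma admissible_untangled (t : 'I_n -> halftrek V L) : admissible t -> exists t',
  [/\ admissible t', forall i, uniq (right_path (t' i))
    & forall i m, tangled t' i m -> ~~ connect (tangled t') m i].
Proof.
case/admissible_simple => {}t tA tU.
have [k] := ubnP (total_size t); elim: k t tA tU => // k IH t tA tU lek.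
have [acy|] := pselect (forall i m, tangled t i m -> ~~ connect (tangled t) m i).
  by exists t.
move=> /existsNP[i /existsNP[m /not_implyP[im /negP/negPn mi]]].
have [t' [A U lt]] := reroute tA tU im mi.
by apply: (IH t') => //; apply: leq_trans lt _.
Qed.

End Admissible.
End Systems.

Local Open Scope ring_scope.

(** * Algebras of functions *)

Section FunctionAlgebras.
Variables (R : comNzRingType) (X : Type) (D : X -> Prop).
Implicit Types f g : X -> R.

(** Only values on D matter, so that K may consist of functions that are
    well behaved on the parameter space alone.  The instances below are the
    polynomial functions of one real variable, and the polynomial, regular and
    rationally identifiable functions on pairs of matrices. *)
Record fun_algebra (K : (X -> R) -> Prop) : Prop := FunAlgebra {
  fun_ext : forall f g, (forall x, D x -> f x = g x) -> K f -> K g;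
  fun_cst : forall c, K (fun=> c);
  fun_add : forall f g, K f -> K g -> K (fun x => f x + g x);
  fun_mul : forall f g, K f -> K g -> K (fun x => f x * g x) }.

Variables (K : (X -> R) -> Prop) (algK : fun_algebra K).

Lemma fun_opp f : K f -> K (fun x => - f x).
Proof.
move=> Kf; apply: fun_ext (fun_mul algK (fun_cst algK (-1)) Kf) => // x _.
by rewrite mulN1r.
Qed.

Lemma fun_sub f g : K f -> K g -> K (fun x => f x - g x).
Proof. by move=> Kf Kg; apply/(fun_add algK)/fun_opp. Qed.

Lemma fun_sum I (r : seq I) (P : pred I) (F : I -> X -> R) :
  (forall i, P i -> K (F i)) -> K (fun x => \sum_(i <- r | P i) F i x).
Proof.
move=> KF; elim: r => [|i r IH].
  by apply: fun_ext (fun_cst algK 0) => // x _; rewrite big_nil.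
have [Pi|nPi] := boolP (P i); last first.
  by apply: fun_ext IH => // x _; rewrite big_cons (negPf nPi).
by apply: fun_ext (fun_add algK (KF i Pi) IH) => // x _; rewrite big_cons Pi.
Qed.

Lemma fun_prod I (r : seq I) (P : pred I) (F : I -> X -> R) :
  (forall i, P i -> K (F i)) -> K (fun x => \prod_(i <- r | P i) F i x).
Proof.
move=> KF; elim: r => [|i r IH].
  by apply: fun_ext (fun_cst algK 1) => // x _; rewrite big_nil.
have [Pi|nPi] := boolP (P i); last first.
  by apply: fun_ext IH => // x _; rewrite big_cons (negPf nPi).
by apply: fun_ext (fun_mul algK (KF i Pi) IH) => // x _; rewrite big_cons Pi.
Qed.

Lemma fun_exp f k : K f -> K (fun x => f x ^+ k).
Proof.
move=> Kf; elim: k => [|k IH]; first exact: fun_cst.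
by apply: fun_ext (fun_mul algK Kf IH) => // x _; rewrite exprS.
Qed.

Lemma fun_det n (A : X -> 'M[R]_n) :
  (forall i j, K (fun x => A x i j)) -> K (fun x => \det (A x)).
Proof.
move=> KA; apply: fun_sum => s _; apply: (fun_mul algK); first exact: fun_cst.
exact: fun_prod.
Qed.

Lemma fun_adj n (A : X -> 'M[R]_n) i j :
  (forall i j, K (fun x => A x i j)) -> K (fun x => (\adj (A x)) i j).
Proof.
move=> KA; apply: (fun_ext algK (f := fun x => cofactor (A x) j i)).
  by move=> x _; rewrite mxE.
apply: (fun_mul algK); first exact: fun_cst.
apply: fun_det => k l.
by apply: fun_ext (KA (lift j k) (lift i l)) => // x _; rewrite !mxE.
Qed.

Lemma fun_mulmx m n p (A : X -> 'M[R]_(m, n)) (B : X -> 'M[R]_(n, p)) i j :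
    (forall i j, K (fun x => A x i j)) -> (forall i j, K (fun x => B x i j)) ->
  K (fun x => (A x *m B x) i j).
Proof.
move=> KA KB.
apply: (fun_ext algK (f := fun x => \sum_k A x i k * B x k j)).
  by move=> x _; rewrite mxE.
by apply: fun_sum => k _; apply: (fun_mul algK).
Qed.

Lemma fun_meval n (p : {mpoly R[n]}) (v : X -> 'I_n -> R) :
  (forall k, K (fun x => v x k)) -> K (fun x => p.@[v x]).
Proof.
move=> Kv.
apply: (fun_ext algK (f := fun x =>
  \sum_(m <- msupp p) p@_m * \prod_i v x i ^+ m i)).
  by move=> x _; rewrite mevalE.
apply: fun_sum => m _; apply: (fun_mul algK); first exact: fun_cst.
by apply: fun_prod => i _; apply: fun_exp.
Qed.

End FunctionAlgebras.

Definition univariate (R : comNzRingType) (f : R -> R) :=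
  exists p : {poly R}, forall s, p.[s] = f s.

Lemma univariate_algebra (R : comNzRingType) :
  fun_algebra (fun=> True) (@univariate R).
Proof.
split.
- by move=> f g fg [p pE]; exists p => s; rewrite pE fg.
- by move=> c; exists c%:P => s; rewrite hornerC.
- by move=> f g [p pE] [q qE]; exists (p + q) => s; rewrite hornerD pE qE.
- by move=> f g [p pE] [q qE]; exists (p * q) => s; rewrite hornerM pE qE.
Qed.

Lemma univariate_id (R : comNzRingType) : univariate (@id R).
Proof. by exists 'X => s; rewrite hornerX. Qed.

(** A nonzero polynomial cannot vanish at all the points 1, 1/2, 1/3, ... *)
Lemma nonroot01 (R : realFieldType) (p : {poly R}) :
  p != 0 -> exists2 s, 0 <= s <= 1 & p.[s] != 0.
Proof.
move=> p0; pose rs : seq R := [seq k.+1%:R^-1 | k <- iota 0 (size p)].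
have rsU : uniq rs.
  rewrite map_inj_uniq ?iota_uniq // => a b /invr_inj/eqP.
  by rewrite eqr_nat eqSS => /eqP.
have [|/allPn[s]] := boolP (all (root p) rs).
  move=> /(max_poly_roots p0)/(_ rsU).
  by rewrite size_map size_iota ltnn.
case/mapP => k _ -> sp; exists k.+1%:R^-1 => //.
by rewrite invr_ge0 ler0n invf_le1 ?ltr0n // ler1n.
Qed.

(** * Support and invertibility of matrices *)

(** N maps the space of vectors supported on Q into itself, hence onto itself
    since it is injective; so its inverse preserves this space too. *)
Lemma invmx_support (F : fieldType) d (N : 'M[F]_d) (Q : pred 'I_d) :
    N \in unitmx -> (forall i j, ~~ Q i -> Q j -> N i j = 0) ->
  forall i j, ~~ Q i -> Q j -> invmx N i j = 0.
Proof.
move=> Nu NQ i j Qi Qj.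
pose P : 'M[F]_d := \matrix_(a, b) ((a == b) && Q a)%:R.
have mulP (A : 'M[F]_d) a b : (A *m P) a b = A a b * (Q b)%:R.
  rewrite mxE (bigD1 b) //= mxE eqxx big1 ?addr0 // => c cb.
  by rewrite mxE (negPf cb) mulr0.
have Pmul (A : 'M[F]_d) a b : (P *m A) a b = (Q a)%:R * A a b.
  rewrite mxE (bigD1 a) //= mxE eqxx big1 ?addr0 // => c cb.
  by rewrite mxE eq_sym (negPf cb) mul0r.
(* The rows of P span the vectors supported on Q. *)
have sub : (P *m N^T <= P)%MS.
  apply/submxP; exists (P *m N^T); apply/matrixP => a b.
  rewrite mulP Pmul mxE; case: (boolP (Q b)) => Qb; first by rewrite mulr1.
  by rewrite mulr0; case: (boolP (Q a)) => Qa; rewrite ?mul0r // NQ ?mulr0.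
have /submxP[X PX] : (P <= P *m N^T)%MS.
  rewrite -(mxrank_leqif_sup sub) mxrankMfree //.
  by rewrite row_free_unit unitmx_tr.
have : (X *m P) j i = 0 by rewrite mulP (negPf Qi) mulr0.
have -> : X *m P = P *m (invmx N)^T.
  by rewrite {2}PX -!mulmxA -trmx_mul mulVmx // trmx1 mulmx1.
by rewrite Pmul Qj mul1r mxE.
Qed.

Lemma unitmx_ker (F : fieldType) n (M : 'M[F]_n) :
  (forall u : 'cV_n, M *m u = 0 -> u = 0) -> M \in unitmx.
Proof.
move=> K; rewrite -unitmx_tr -row_free_unit -kermx_eq0.
apply/rowV0P => u /sub_kermxP uM; apply: trmx_inj.
by rewrite trmx0; apply: K; rewrite -[M]trmxK -trmx_mul uM trmx0.
Qed.

(** The matrix is triangular with respect to the order given by the key. *)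
Lemma unitmx_key (F : fieldType) n (M : 'M[F]_n) (key : 'I_n -> nat) :
    (forall i, M i i != 0) ->
    (forall i j, i != j -> M i j != 0 -> (key j < key i)%N) ->
  M \in unitmx.
Proof.
move=> Md Mk; apply: unitmx_ker => u /colP uM; apply/colP => i.
rewrite [RHS]mxE; have [k] := ubnP (key i); elim: k i => // k IH i lek.
have := uM i; rewrite !mxE (bigD1 i) //= big1 ?addr0 => [/eqP|j ji]; last first.
  have [->|Mij] := eqVneq (M i j) 0; first by rewrite mul0r.
  rewrite IH ?mulr0 //; apply: (@leq_trans (key i)); last by rewrite -ltnS.
  by apply: Mk; rewrite // eq_sym.
by rewrite mulf_eq0 (negPf (Md i)) => /eqP.
Qed.

(** * Generic points and identifiable functions *)

Section Generic.
Variables (R : realType) (V L : finType) (G : lf_graph V L).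
Local Notation d := #|V|.
Local Notation pairs := ('M[R]_d * 'M[R]_d)%type.
Local Notation Theta := (Theta (R := R) G).

Lemma sum_nodes (T : finType) (F : 'I_#|T| -> R) :
  \sum_k F k = \sum_(u : T) F (enum_rank u).
Proof. by rewrite (reindex (@enum_rank T)) //; apply/onW_bij/enum_rank_bij. Qed.

Definition polynomial (f : pairs -> R) := exists p, forall x, eval2 p x = f x.

Lemma polynomial_algebra : fun_algebra (fun=> True) polynomial.
Proof.
split.
- by move=> f g fg [p pE]; exists p => s; rewrite pE fg.
- by move=> c; exists c%:MP => s; rewrite /eval2 mevalC.
- move=> f g [p pE] [q qE]; exists (p + q) => s.
  by rewrite -pE -qE /eval2 mevalD.
- move=> f g [p pE] [q qE]; exists (p * q) => s.
  by rewrite -pE -qE /eval2 mevalM.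
Qed.

Lemma polynomial_fst i j : polynomial (fun x => x.1 i j).
Proof.
exists 'X_(lshift _ (mxvec_index i j)) => x.
by rewrite /eval2 mevalXU row_mxEl mxvecE.
Qed.

Lemma polynomial_snd i j : polynomial (fun x => x.2 i j).
Proof.
exists 'X_(rshift _ (mxvec_index i j)) => x.
by rewrite /eval2 mevalXU row_mxEr mxvecE.
Qed.

Definition delta (x : pairs) := \det (1%:M - x.1).

Lemma delta_neq0 x : Theta x -> delta x != 0.
Proof. by case=> [[_]]; rewrite unitmxE unitfE. Qed.

Lemma polynomial_sub1 i j : polynomial (fun x => (1%:M - x.1) i j).
Proof.
apply: (fun_ext polynomial_algebra (f := fun x => (i == j)%:R - x.1 i j)).
  by move=> x _; rewrite !mxE.
apply: (fun_sub polynomial_algebra); first exact: (fun_cst polynomial_algebra).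
exact: polynomial_fst.
Qed.

(** The restrictions to Theta of the regular functions on the locus where
    I - Lam is invertible. *)
Definition regular (f : pairs -> R) := exists2 g, polynomial g &
  exists k, forall x, Theta x -> f x * delta x ^+ k = g x.

Lemma regular_algebra : fun_algebra Theta regular.
Proof.
have Dk k : polynomial (fun x => delta x ^+ k).
  apply: (fun_exp polynomial_algebra); apply: (fun_det polynomial_algebra).
  exact: polynomial_sub1.
split.
- move=> f g fg [p Pp [k pE]]; exists p => //; exists k => s Ts.
  by rewrite -fg // pE.
- move=> c; exists (fun=> c); first exact: (fun_cst polynomial_algebra).
  by exists 0%N => x _; rewrite expr0 mulr1.
- move=> f g [p Pp [k pE]] [q Pq [m qE]].
  exists (fun x => p x * delta x ^+ m + q x * delta x ^+ k).
    by apply: (fun_add polynomial_algebra); apply: (fun_mul polynomial_algebra).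
  exists (k + m)%N => x Tx; rewrite exprD mulrDl mulrA pE //.
  by rewrite [delta x ^+ k * _]mulrC mulrA qE.
- move=> f g [p Pp [k pE]] [q Pq [m qE]].
  exists (fun x => p x * q x); first exact: (fun_mul polynomial_algebra).
  by exists (k + m)%N => x Tx; rewrite exprD mulrACA pE // qE.
Qed.

Lemma polynomial_regular f : polynomial f -> regular f.
Proof. by move=> Pf; exists f => //; exists 0%N => x _; rewrite expr0 mulr1. Qed.

Lemma regular_inv i j : regular (fun x => invmx (1%:M - x.1) i j).
Proof.
exists (fun x => (\adj (1%:M - x.1)) i j).
  by apply: (fun_adj polynomial_algebra) => k m; apply: polynomial_sub1.
exists 1%N => x Tx; have d0 := delta_neq0 Tx; case: Tx => [[_ u] _].
by rewrite /invmx u mxE expr1 mulrAC mulVf ?mul1r.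
Qed.

(** The parameters (Lam, Gam, W) of two points of Theta are joined by a segment.
    On it P, Q and det(I - Lam) are nonzero polynomials in one variable, hence
    they are simultaneously nonzero at some point of [0, 1], where W stays
    positive. *)
Lemma Theta_irreducible P Q x y : Theta x -> Theta y ->
    eval2 P x != 0 -> eval2 Q y != 0 ->
  exists z, [/\ Theta z, eval2 P z != 0 & eval2 Q z != 0].
Proof.
case: x => A _ [[/= Asupp Aun] [G0 [W0 [G0s [W0d W0p] /= ->]]]].
case: y => B _ [[/= Bsupp Bun] [G1 [W1 [G1s [W1d W1p] /= ->]]]] P0 Q1.
pose seg m n (C E : 'M[R]_(m, n)) s : 'M[R]_(m, n) := (1 - s) *: C + s *: E.
have seg0 m n (C E : 'M[R]_(m, n)) : seg m n C E 0 = C.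
  by rewrite /seg subr0 scale1r scale0r addr0.
have seg1 m n (C E : 'M[R]_(m, n)) : seg m n C E 1 = E.
  by rewrite /seg subrr scale1r scale0r add0r.
have ua := univariate_algebra R; have cst := fun_cst ua.
have segU m n (C E : 'M[R]_(m, n)) i j : univariate (fun s => seg m n C E s i j).
  apply: (fun_ext ua (f := fun s => (1 - s) * C i j + s * E i j)).
    by move=> s _; rewrite !mxE.
  apply: (fun_add ua); apply: (fun_mul ua) => //; last exact: univariate_id.
  apply: (fun_sub ua) => //; exact: univariate_id.
pose z s : pairs := (seg _ _ A B s, tau (seg _ _ G0 G1 s) (seg _ _ W0 W1 s)).
have zU S : univariate (fun s => eval2 S (z s)).
  apply: (fun_meval ua) => k.
  case: (split_ordP k) => c ->; case/mxvec_indexP: c => i j.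
    apply: (fun_ext ua (f := fun s => (z s).1 i j)) => [s _|].
      by rewrite row_mxEl mxvecE.
    exact: segU.
  apply: (fun_ext ua (f := fun s => seg _ _ W0 W1 s i j +
      ((seg _ _ G0 G1 s)^T *m seg _ _ G0 G1 s) i j)) => [s _|].
    by rewrite row_mxEr mxvecE /= /tau [RHS]mxE.
  apply: (fun_add ua); first exact: segU.
  apply: (fun_mulmx ua) => a b; last exact: segU.
  apply: (fun_ext ua (f := fun s => seg _ _ G0 G1 s b a)) => // s _.
  by rewrite [RHS]mxE.
have [p pE] := zU P; have [q qE] := zU Q.
have [r rE] : univariate (fun s => delta (z s)).
  apply: (fun_det ua) => i j.
  apply: (fun_ext ua (f := fun s => (1%:M : 'M[R]_d) i j - seg _ _ A B s i j)).
    by move=> s _; rewrite [RHS]mxE; congr (_ + _); rewrite [RHS]mxE.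
  by apply: (fun_sub ua) => //; apply: segU.
have p0 : p != 0.
  by apply: contraNneq P0 => p0; have := pE 0; rewrite p0 horner0 /z !seg0 => <-.
have q0 : q != 0.
  by apply: contraNneq Q1 => q0; have := qE 1; rewrite q0 horner0 /z !seg1 => <-.
have r0 : r != 0.
  move: Aun; rewrite unitmxE unitfE; apply: contraNneq => r0.
  by have := rE 0; rewrite r0 horner0 /z /delta /= !seg0 => <-.
have [s /andP[s0 s1]] := nonroot01 (mulf_neq0 (mulf_neq0 p0 q0) r0).
rewrite !hornerM !mulf_eq0 !negb_or pE qE rE => /andP[/andP[Ps Qs] rs].
exists (z s); split=> //; split.
  split; last by rewrite unitmxE unitfE.
  by move=> w v wv; rewrite !mxE Asupp // Bsupp // !mulr0 addr0.
exists (seg _ _ G0 G1 s), (seg _ _ W0 W1 s); split=> //.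
  by move=> w v wv; rewrite !mxE G0s // G1s // !mulr0 addr0.
split; first apply/is_diag_mxP => i j ij.
  by rewrite !mxE (is_diag_mxP W0d) // (is_diag_mxP W1d) // !mulr0 addr0.
move=> i; rewrite !mxE; case: (ltrP 0 s) => [sp|sn].
  rewrite ltr_wpDl ?mulr_gt0 // mulr_ge0 ?subr_ge0 //; exact/ltW.
have -> : s = 0 by apply/le_anti; rewrite sn s0.
by rewrite subr0 mul1r mul0r addr0.
Qed.

(** [rationally_identifiable] for an arbitrary function of the parameters.  The
    exceptional set is cut out by one polynomial F not vanishing on Theta, and
    division is avoided. *)
Definition identifiable (f : pairs -> R) : Prop :=
  exists2 F, (exists2 x, Theta x & eval2 F x != 0) &
  exists p q, forall x, Theta x -> eval2 F x != 0 ->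
    eval1 q (phi x) != 0 /\ eval1 p (phi x) = f x * eval1 q (phi x).

(** A proper algebraic subset of the closure lies in the zero set of one of its
    equations which does not vanish identically on Theta. *)
Lemma identifiable_edge v w :
  rationally_identifiable R G v w <->
  identifiable (fun x => x.1 (enum_rank v) (enum_rank w)).
Proof.
split=> [[A [[[I AI] _ [x cx nAx]] [p [q pq]]]]|[F [x0 Tx0 Fx0] [p [q pq]]]].
  have [F IF Fx] : exists2 F, I F & eval2 F x != 0.
    apply: contrapT => no; apply: nAx; apply/AI => F IF.
    by apply/eqP/negPn/negP => Fx; apply: no; exists F.
  exists F.
    apply: contrapT => no; move/negP: Fx; apply; apply/eqP/cx => y Ty.
    by apply/eqP/negPn/negP => Fy; apply: no; exists y.
  exists p, q => y Ty Fy.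
  have [||q0 <-] := pq y => //; last by rewrite mulfVK.
  by move/AI/(_ _ IF)/eqP; apply/negP.
exists (fun x => zclosure Theta x /\ eval2 F x = 0); split.
  split.
  - exists (fun P => (forall x, Theta x -> eval2 P x = 0) \/ P = F) => x.
    split=> [[cx Fx] P [/cx //|->//]|zx].
    by split=> [P TP|]; apply: zx; [left|right].
  - by move=> x [].
  - by exists x0 => [P TP|[_ /eqP]]; [apply: TP|apply/negP].
exists p, q => x Tx nA.
have [||q0 ->] := pq x => //; last by rewrite mulfK.
by apply/eqP => Fx; apply: nA; split=> // P; apply.
Qed.

Hypothesis Theta_inh : exists x, Theta x.

Lemma identifiable_algebra : fun_algebra Theta identifiable.
Proof.
split.
- move=> f g fg [F F0 [p [q pq]]]; exists F => //; exists p, q => x Tx Fx.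
  by rewrite -fg //; apply: pq.
- move=> c; have [x Tx] := Theta_inh; exists 1%:MP.
    by exists x; rewrite // /eval2 mevalC oner_neq0.
  exists c%:MP, 1%:MP => y _ _; rewrite /eval1 !mevalC mulr1; split=> //.
  exact: oner_neq0.
- move=> f g [F [x Tx Fx] [p [q pq]]] [F' [y Ty Fy] [p' [q' pq']]].
  have [z [Tz Fz Fz']] := Theta_irreducible Tx Ty Fx Fy.
  exists (F * F'); first by exists z; rewrite // /eval2 mevalM mulf_neq0.
  exists (p * q' + p' * q), (q * q') => t Tt.
  rewrite /eval2 mevalM mulf_eq0 negb_or.
  move=> /andP[/(pq t Tt)[q0 pE] /(pq' t Tt)[q0' pE']].
  move: q0 q0' pE pE'; rewrite /eval1 mevalD !mevalM => q0 q0' -> ->.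
  rewrite mulf_neq0 // mulrDl !mulrA; split=> //; congr (_ + _).
  exact: mulrAC.
- move=> f g [F [x Tx Fx] [p [q pq]]] [F' [y Ty Fy] [p' [q' pq']]].
  have [z [Tz Fz Fz']] := Theta_irreducible Tx Ty Fx Fy.
  exists (F * F'); first by exists z; rewrite // /eval2 mevalM mulf_neq0.
  exists (p * p'), (q * q') => t Tt.
  rewrite /eval2 mevalM mulf_eq0 negb_or.
  move=> /andP[/(pq t Tt)[q0 pE] /(pq' t Tt)[q0' pE']].
  move: q0 q0' pE pE'; rewrite /eval1 !mevalM => q0 q0' -> ->.
  by rewrite mulf_neq0 // mulrACA.
Qed.

Lemma identifiable_phi i j : identifiable (fun x => phi x i j).
Proof.
have [x Tx] := Theta_inh; exists 1%:MP.
  by exists x; rewrite // /eval2 mevalC oner_neq0.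
exists 'X_(mxvec_index i j), 1%:MP => y _ _.
by rewrite /eval1 mevalC mevalXU mxvecE mulr1 oner_neq0.
Qed.

Lemma identifiable_div f g h : identifiable f -> identifiable g -> regular g ->
    (exists2 x, Theta x & g x != 0) ->
    (forall x, Theta x -> g x != 0 -> h x * g x = f x) ->
  identifiable h.
Proof.
move=> [F [x Tx Fx] [p [q pq]]] [F' [y Ty Fy] [p' [q' pq']]].
move=> [S0 [S S0E] [k SE]] [t Tt gt] hE.
have [z [Tz Fz Fz']] := Theta_irreducible Tx Ty Fx Fy.
have FFz : eval2 (F * F') z != 0 by rewrite /eval2 mevalM mulf_neq0.
have St : eval2 S t != 0.
  by rewrite S0E -SE // mulf_neq0 // expf_neq0 // (delta_neq0 Tt).
have [w [Tw Fw Fw']] := Theta_irreducible Tz Tt FFz St.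
exists (F * F' * S).
  by exists w => //; rewrite /eval2 mevalM mulf_neq0.
exists (p * q'), (q * p') => u Tu.
rewrite /eval2 2!mevalM 2!mulf_eq0 !negb_or => /andP[/andP[]].
move=> /(pq u Tu)[q0 pE] /(pq' u Tu)[q0' pE'].
rewrite -[meval _ _]/(eval2 S u) S0E -SE // mulf_eq0 negb_or => /andP[gu _].
move: q0 q0' pE pE'; rewrite /eval1 !mevalM => q0 q0' -> ->.
rewrite !mulf_neq0 // -hE // -!mulrA; split=> //; congr (_ * _).
by rewrite mulrCA mulrA mulrC mulrA.
Qed.

End Generic.

(** * A point where the coefficient matrix is invertible *)

Lemma mulmx_neq0 (R : nzRingType) m n p
    (A : 'M[R]_(m, n)) (B : 'M[R]_(n, p)) i j :
  (A *m B) i j != 0 -> exists k, A i k != 0 /\ B k j != 0.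
Proof.
rewrite mxE => AB; apply: contrapT => no; move/negP: AB; apply; apply/eqP.
apply: big1 => k _; have [->|Aik] := eqVneq (A i k) 0; first by rewrite mul0r.
have [->|Bkj] := eqVneq (B k j) 0; first by rewrite mulr0.
by case: no; exists k.
Qed.

Definition nonneg_mx (R : numDomainType) m n (A : 'M[R]_(m, n)) :=
  forall i j, 0 <= A i j.

Lemma nonneg_mulmx (R : numDomainType) m n p
    (A : 'M[R]_(m, n)) (B : 'M[R]_(n, p)) :
  nonneg_mx A -> nonneg_mx B -> nonneg_mx (A *m B).
Proof. by move=> A0 B0 i j; rewrite mxE sumr_ge0 // => k _; rewrite mulr_ge0. Qed.

Lemma mulmx_gt0 (R : numDomainType) m n p
    (A : 'M[R]_(m, n)) (B : 'M[R]_(n, p)) i k j :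
  nonneg_mx A -> nonneg_mx B -> 0 < A i k -> 0 < B k j -> 0 < (A *m B) i j.
Proof.
move=> A0 B0 Ap Bp; rewrite mxE (bigD1 k) //= ltr_pwDl ?mulr_gt0 //.
by rewrite sumr_ge0 // => c _; rewrite mulr_ge0.
Qed.

Lemma nonneg_bool (R : numDomainType) m n (P : 'I_m -> 'I_n -> bool) :
  nonneg_mx (\matrix_(i, j) (P i j)%:R : 'M[R]_(m, n)).
Proof. by move=> i j; rewrite mxE ler0n. Qed.

Section Coefficients.
Variables (R : realType) (V L : finType) (G : lf_graph V L).
Local Notation d := #|V|.
Local Notation pairs := ('M[R]_d * 'M[R]_d)%type.
Local Notation Theta := (Theta (R := R) G).
Local Notation rk := enum_rank.

(** Its entries are the total effects: sums over directed paths when Lam is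
    nilpotent. *)
Definition effects (x : pairs) : 'M[R]_d := invmx (1%:M - x.1).

(** The transposed vector e of the introduction is row y of this matrix, for b
    telling whether y is reachable. *)
Definition row_factor (b : bool) (x : pairs) : 'M[R]_d :=
  if b then 1%:M else (effects x)^T.

(** For columns in Z the unknown multiplies a column of e^T Om, for those in
    pa(v) a column of e^T Om T. *)
Definition column_factor (b : bool) (x : pairs) : 'M[R]_d :=
  if b then 1%:M else effects x.

Definition coefficients n (t : 'I_n -> halftrek V L) (a b : V -> bool) x :
    'M[R]_n :=
  \matrix_(i, j) (row_factor (a (source (t i))) x *m x.2 *m
    column_factor (b (target (t j))) x) (rk (source (t i))) (rk (target (t j))).

Section Witness.
Variables (n : nat) (Y B Z : {set V}) (H : {set L}) (t : 'I_n -> halftrek V L).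
Hypothesis tA : admissible G Y B Z H t.
Hypothesis tU : forall i, uniq (right_path (t i)).
Hypothesis tC : forall i m, tangled t i m -> ~~ connect (tangled t) m i.
Variable a : V -> bool.

Let P m := right_path (t m).
Let y i := source (t i).
Let s i := start (t i).

Let Pinj i j x : x \in P i -> x \in P j -> i = j.
Proof. exact: right_path_inj (adm_sided tA). Qed.

Definition bound := (\max_m size (right_path (t m)))%N.

(** Encodes the lexicographic order on depth and on the position along the path
    that contains the source; [bound] exceeds all positions. *)
Definition key i : nat :=
  if [pick m | tangled t i m] is Some m
  then ((depth (tangled t) m).+1 * bound +
    index (source (t i)) (right_path (t m)))%N
  else 0%N.

Lemma keyE i m : tangled t i m -> key i =
  ((depth (tangled t) m).+1 * bound + index (y i) (P m))%N.
Proof.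
rewrite /key; case: pickP => [m' /andP[im' _] /andP[im _]|/(_ m)->//].
by rewrite (Pinj im' im).
Qed.

Lemma index_bound i m : tangled t i m -> (index (y i) (P m) < bound)%N.
Proof.
case/andP=> im _; apply: leq_trans (_ : size (P m) <= _)%N.
  by rewrite index_mem.
exact: (leq_bigmax (F := fun m => size (right_path (t m)))).
Qed.

Lemma key_tangled i j : tangled t i j -> (key j < key i)%N.
Proof.
move=> ij; rewrite (keyE ij); have ib := index_bound ij.
have [m|no] := pickP (tangled t j); last first.
  rewrite /key; case: pickP => [m|_]; first by rewrite no.
  by apply: leq_trans (leq_addr _ _); rewrite muln_gt0 (leq_trans _ ib).
move=> jm; rewrite (keyE jm); have lt := depth_lt jm (tC jm).
apply: leq_trans (leq_addr _ _).
apply: leq_trans (_ : (depth (tangled t) m).+2 * bound <= _)%N.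
  by rewrite [ltnRHS]mulSnr ltn_add2l index_bound.
by rewrite leq_mul2r ltnS lt orbT.
Qed.

Lemma key_sibling i j m : tangled t i m -> tangled t j m ->
  (index (y j) (P m) < index (y i) (P m))%N -> (key j < key i)%N.
Proof. by move=> im jm; rewrite (keyE im) (keyE jm) ltn_add2l. Qed.

Definition before x w := [exists m, [&& x \in P m, w \in P m
  & index x (P m) <= index w (P m)]]%N.

Definition next x w := [exists m, [&& x \in P m, w \in P m
  & index w (P m) == (index x (P m)).+1]].

(** The edges used by the system get weight 1: the observed ones here, the
    latent ones in [Gam0]. *)
Definition Lam0 : 'M[R]_d := \matrix_(i, j) (next (enum_val i) (enum_val j))%:R.
Definition T0 : 'M[R]_d :=
  \matrix_(i, j) ((i == j) || before (enum_val i) (enum_val j))%:R.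
Definition Gam0 : 'M[R]_(#|L|, d) := \matrix_(h, w) [exists i,
  (latent (t i) == Some (enum_val h)) && (enum_val w \in [:: y i; s i])]%:R.
Definition x0 : pairs := (Lam0, tau Gam0 1%:M).

Lemma T0E x w : T0 (rk x) (rk w) = ((x == w) || before x w)%:R.
Proof. by rewrite mxE !enum_rankK (inj_eq enum_rank_inj). Qed.

Lemma Lam0E x w : Lam0 (rk x) (rk w) = (next x w)%:R.
Proof. by rewrite mxE !enum_rankK. Qed.

Lemma beforeE m x w : x \in P m ->
  before x w = (w \in P m) && (index x (P m) <= index w (P m))%N.
Proof.
move=> xm; apply/existsP/idP => [[m' /and3P[xm' wm le]]|/andP[wm le]].
  by rewrite (Pinj xm xm') wm.
by exists m; rewrite xm wm.
Qed.

Lemma nextE m x w : x \in P m ->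
  next x w = (w \in P m) && (index w (P m) == (index x (P m)).+1).
Proof.
move=> xm; apply/existsP/idP => [[m' /and3P[xm' wm le]]|/andP[wm le]].
  by rewrite (Pinj xm xm') wm.
by exists m; rewrite xm wm.
Qed.

(** Lam0 maps each node to its successor on the path through it, if any, so its
    powers add up to T0.  Row x of the identity says that being at or before w
    differs, between x and its successor, only for w = x. *)
Lemma Lam0_T0 : (1%:M - Lam0) *m T0 = 1%:M.
Proof.
apply/matrixP => i j; rewrite -(enum_valK i) -(enum_valK j).
set x := enum_val i; set w := enum_val j.
rewrite mulmxBl mul1mx mxE [X in _ + X]mxE T0E mxE sum_nodes.
rewrite [RHS]mxE (inj_eq enum_rank_inj).
under eq_bigr do rewrite Lam0E T0E.
have [m xm|none] := pickP (fun m => x \in P m); last first.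
  have -> : before x w = false.
    by apply/existsP => -[m]; rewrite none.
  rewrite big1 ?subr0 ?orbF // => u _.
  have -> : next x u = false.
    by apply/existsP => -[m]; rewrite none.
  by rewrite mul0r.
under eq_bigr => u _ do rewrite (nextE _ xm).
rewrite (beforeE _ xm).
have idx u : u \in P m -> (x == u) = (index x (P m) == index u (P m)).
  move=> um; apply/eqP/eqP => [->//|e].
  by rewrite -(nth_index x xm) e nth_index.
have [lt|ge] := ltnP (index x (P m)).+1 (size (P m)).
  pose u := nth x (P m) (index x (P m)).+1.
  have um : u \in P m by apply: mem_nth.
  have iu : index u (P m) = (index x (P m)).+1 by apply: index_uniq; last exact: tU.
  rewrite (bigD1 u) //= um iu eqxx mul1r big1 ?addr0 => [|u' u'u]; last first.
    have [u'm|_] /= := boolP (u' \in P m); last by rewrite mul0r.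
    have [e|_] := eqVneq; last by rewrite mul0r.
    by move: u'u; rewrite -(nth_index x u'm) e /u eqxx.
  rewrite (beforeE _ um) iu.
  have [wm|wm] /= := boolP (w \in P m); last first.
    have -> : x == w = false by apply: contraNF wm => /eqP<-.
    have -> : u == w = false by apply: contraNF wm => /eqP<-.
    by rewrite subrr.
  rewrite idx //.
  have -> : (u == w) = (index w (P m) == (index x (P m)).+1).
    apply/eqP/eqP => [<-//|e].
    by rewrite /u -e nth_index.
  case: (ltngtP (index x (P m)) (index w (P m))) => [lw|gw|->] /=.
  - by rewrite orbT subrr.
  - by rewrite orbF ltn_eqF ?subr0 // (ltn_trans gw).
  - by rewrite orbF ltn_eqF ?subr0.
rewrite big1 ?subr0 => [|u _].
  have [wm|wm] /= := boolP (w \in P m); last by rewrite orbF.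
  rewrite idx //; congr (nat_of_bool _)%:R; apply/orb_idr => le.
  rewrite eqn_leq le /= -ltnS; apply: leq_trans ge.
  by rewrite index_mem.
have [um|_] /= := boolP (u \in P m); last by rewrite mul0r.
have [e|_] := eqVneq; last by rewrite mul0r.
by move: um; rewrite -index_mem e ltnNge ge.
Qed.

Lemma effects_x0 : effects x0 = T0.
Proof.
have [u _] := mulmx1_unit Lam0_T0.
by rewrite -[RHS]mul1mx -(mulVmx u) -mulmxA /= Lam0_T0 mulmx1.
Qed.

Lemma Theta_x0 : Theta x0.
Proof.
split; [split|].
- move=> w v; apply: contraNeq; rewrite /= Lam0E pnatr_eq0 eqb0 negbK.
  rewrite /next => /existsP[m /and3P[wm vm /eqP e]].
  have := sorted_right_path (let: And5 h _ _ _ _ := adm_system tA in h m).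
  move/(sortedP w)/(_ (index w (P m))); rewrite -/(P m) -e index_mem => /(_ vm).
  by rewrite !nth_index.
- by have [] := mulmx1_unit Lam0_T0.
- exists Gam0, 1%:M; split=> //.
    move=> h w; apply: contraNeq; rewrite mxE pnatr_eq0 eqb0 negbK !enum_rankK.
    case/existsP=> i /andP[/eqP ih].
    have [e1 e2] := latent_edges (let: And5 h _ _ _ _ := adm_system tA in h i) ih.
    by rewrite !inE => /orP[]/eqP->.
  by split; [apply: scalar_mx_is_diag|move=> i; rewrite mxE eqxx ltr01].
Qed.

Lemma Om0E w x : tau Gam0 1%:M (rk w) (rk x) =
  (w == x)%:R + \sum_h Gam0 h (rk w) * Gam0 h (rk x).
Proof.
rewrite !mxE (inj_eq enum_rank_inj); congr (_ + _).
by apply: eq_bigr => h _; rewrite [_^T _ _]mxE.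
Qed.

(** Distinct half-treks use distinct latent nodes, so each latent node links only
    the source and the start of its own half-trek. *)
Lemma Om0_neq0 w x : tau Gam0 1%:M (rk w) (rk x) != 0 -> w = x \/
  exists k, [/\ isSome (latent (t k)), w \in [:: y k; s k] & x \in [:: y k; s k]].
Proof.
rewrite Om0E => ne; have [->|wx] := eqVneq w x; [by left|right].
apply: contrapT => no; move/negP: ne; apply; rewrite (negPf wx) add0r.
apply/eqP/big1 => h _; rewrite !mxE !enum_rankK.
case: existsP => [[i /andP[/eqP ih wi]]|_]; last by rewrite mul0r.
case: existsP => [[j /andP[/eqP jh xj]]|_]; last by rewrite mulr0.
case: no; exists i; rewrite ih wi; split=> //.
by rewrite (latent_inj (adm_sided tA) ih jh).
Qed.

Lemma Om0_nonneg : nonneg_mx (tau Gam0 1%:M).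
Proof.
move=> i j; rewrite mxE addr_ge0 //; first by rewrite mxE ler0n.
by apply: nonneg_mulmx => [u v|]; [rewrite 2!mxE ler0n|apply: nonneg_bool].
Qed.

Lemma T0_nonneg : nonneg_mx T0. Proof. exact: nonneg_bool. Qed.

Lemma row_factor_nonneg b : nonneg_mx (row_factor b x0).
Proof.
rewrite /row_factor effects_x0 => i j; case: b; rewrite mxE ?ler0n //.
exact: T0_nonneg.
Qed.

Lemma column_factor_nonneg b : nonneg_mx (column_factor b x0).
Proof.
rewrite /column_factor effects_x0 => i j; case: b; last exact: T0_nonneg.
by rewrite mxE ler0n.
Qed.

Lemma column_factor_neq0 b j x :
  column_factor b x0 (rk x) (rk (target (t j))) != 0 -> x \in P j.
Proof.
have cj := target_mem (t j).
rewrite /column_factor effects_x0; case: b; rewrite ?T0E ?mxE.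
  by rewrite pnatr_eq0 eqb0 negbK (inj_eq enum_rank_inj) => /eqP->.
rewrite pnatr_eq0 eqb0 negbK => /orP[/eqP->//|/existsP[m /and3P[xm cm _]]].
by rewrite (Pinj cj cm).
Qed.

Lemma row_factor_neq0 b w v : row_factor b x0 (rk v) (rk w) != 0 ->
  w = v \/ before w v.
Proof.
rewrite /row_factor effects_x0; case: b; rewrite ?mxE.
  by rewrite pnatr_eq0 eqb0 negbK (inj_eq enum_rank_inj) => /eqP->; left.
rewrite !enum_rankK (inj_eq enum_rank_inj) pnatr_eq0 eqb0 negbK.
by case/orP=> [/eqP|]; [left|right].
Qed.

(** A nonzero entry M_ij comes from a node w at or before the source of i, an
    entry of Om linking w to x, and a node x on the path of j.  Going through the
    possible links, j is reached from i by one or two steps of [tangled], except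
    when w is the source and x the start of j itself, and w precedes the source
    of i on a common path. *)
Lemma entry_key w x i j : i != j -> w = y i \/ before w (y i) ->
    w = x \/ (exists k, [/\ isSome (latent (t k)), w \in [:: y k; s k]
      & x \in [:: y k; s k]]) ->
  x \in P j -> (key j < key i)%N.
Proof.
move=> ij wy wx xj.
have kt i' j' := @key_tangled i' j'.
have lat_t k l : isSome (latent (t l)) -> y k \in P l -> tangled t k l.
  by move=> kl; rewrite /tangled kl orbT andbT.
have tij : y i \in P j -> (key j < key i)%N.
  by move=> yij; apply: kt; rewrite /tangled yij ij.
(* Here no initial segment is used in row i. *)
have [wE|wy'] := eqVneq w (y i).
  case: wx => [xE|[k [kl]]]; first by apply: tij; rewrite -wE xE.
  rewrite !inE wE => /orP[/eqP yik|/eqP yik] /orP[]/eqP xE.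
  - by apply: tij; rewrite yik -xE.
  - have ik : i = k by case: (adm_system tA) => _ + _ _ _; apply.
    by move: ij; rewrite (@Pinj i j x) ?eqxx // xE ik start_right_path.
  - rewrite xE in xj; have jk : tangled t k j.
      by rewrite /tangled xj; case: eqVneq => //= <-.
    apply: ltn_trans (kt _ _ jk) (kt _ _ _); apply: lat_t => //.
    by rewrite yik start_right_path.
  - have jk : j = k by apply: Pinj xj _; rewrite xE start_right_path.
    by apply: tij; rewrite jk yik start_right_path.
case: wy => [/eqP|/existsP[m /and3P[wm ym le]]]; first by rewrite (negPf wy').
have lt : (index w (P m) < index (y i) (P m))%N.
  rewrite ltn_neqAle le andbT; apply: contra wy' => /eqP e.
  by rewrite -(nth_index w wm) e nth_index.
have im : tangled t i m.
  rewrite /tangled ym /=; case: (eqVneq i m) => //= im.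
  case E: (latent _) => //; move: lt.
  by rewrite -im /y -(start_directed (_ : latent (t i) = None)) ?im // index_start.
have xm : x \in P m -> (key j < key i)%N.
  by move=> xm; apply: kt; rewrite (Pinj xj xm).
case: wx => [xE|[k [kl]]]; first by apply: xm; rewrite -xE.
rewrite !inE => /orP[/eqP wE|/eqP wE] /orP[]/eqP xE.
- by apply: xm; rewrite xE -wE.
(* The source of j precedes that of i on the path of m. *)
- have jk : j = k by apply: Pinj xj _; rewrite xE start_right_path.
  apply: (@key_sibling _ _ m) => //; last by rewrite jk -wE.
  rewrite /tangled jk -[source _]/(y k) -wE wm; case: eqVneq => //= km.
  by rewrite -km.
- have mk : m = k by apply: Pinj wm _; rewrite wE start_right_path.
  subst k; apply: ltn_trans (kt m j _) (kt _ _ im).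
  by rewrite /tangled -[source _]/(y m) -xE xj; case: eqVneq => //= <-.
- have mk : m = k by apply: Pinj wm _; rewrite wE start_right_path.
  by apply: xm; rewrite xE mk start_right_path.
Qed.

(** All entries are sums of nonnegative terms, so one positive term suffices on
    the diagonal: the one following the half-trek from its source to its start
    and on to its target. *)
Lemma coefficients_x0_unit : coefficients t a (mem Z) x0 \in unitmx.
Proof.
apply: (unitmx_key (key := key)) => [i|i j ij].
  rewrite mxE gt_eqF //.
  apply: (@mulmx_gt0 _ _ _ _ _ _ _ (rk (s i))).
  - by apply: nonneg_mulmx; [apply: row_factor_nonneg|apply: Om0_nonneg].
  - exact: column_factor_nonneg.
  - apply: (@mulmx_gt0 _ _ _ _ _ _ _ (rk (y i))).
    + exact: row_factor_nonneg.
    + exact: Om0_nonneg.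
    + rewrite /row_factor effects_x0; case: ifP => _; rewrite mxE ?eqxx ?ltr01 //.
      by rewrite T0E eqxx ltr01.
    + rewrite Om0E; case E : (latent (t i)) => [h|]; last first.
        rewrite /s (start_directed E) eqxx ltr_pwDl ?ltr01 //.
        by rewrite sumr_ge0 // => h _; rewrite mulr_ge0 // nonneg_bool.
      rewrite ltr_wpDl ?ler0n // (bigD1 (rk h)) //= ltr_pwDl //.
        rewrite mulr_gt0 // mxE !enum_rankK ltr0n lt0b; apply/existsP; exists i.
          by rewrite E eqxx !inE eqxx.
        by rewrite E eqxx !inE eqxx orbT.
      by rewrite sumr_ge0 // => k _; rewrite mulr_ge0 // nonneg_bool.
  - rewrite /column_factor effects_x0; case: ifP => [/(adm_Z tA)|_].
      by rewrite /s => -[b [h [_ _ ->]]] /=; rewrite mxE eqxx ltr01.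
    rewrite T0E (_ : before _ _) ?orbT ?ltr01 //; apply/existsP; exists i.
    by rewrite start_right_path target_mem index_start.
rewrite mxE => /mulmx_neq0[x [/mulmx_neq0[w [Sw Om]] Ux]].
rewrite -(enum_valK x) -(enum_valK w) in Sw Om Ux.
apply: entry_key ij (row_factor_neq0 Sw) (Om0_neq0 Om) _.
exact: column_factor_neq0 Ux.
Qed.

End Witness.
End Coefficients.

(** * The linear system for the edges into a node *)

Section Equations.
Variables (R : realType) (V L : finType) (G : lf_graph V L).
Local Notation d := #|V|.
Local Notation pairs := ('M[R]_d * 'M[R]_d)%type.
Local Notation Theta := (Theta (R := R) G).
Local Notation rk := enum_rank.

Lemma regular_coefficients n (t : 'I_n -> halftrek V L) a b i j :
  regular G (fun x : pairs => coefficients t a b x i j).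
Proof.
have ra := regular_algebra R G; have cst := fun_cst ra.
have one k l : regular G (fun x : pairs => (1%:M : 'M[R]_d) k l) by exact: cst.
apply: (fun_ext ra (f := fun x : pairs => (row_factor (a (source (t i))) x *m x.2 *m
  column_factor (b (target (t j))) x) (rk (source (t i))) (rk (target (t j))))).
  by move=> x _; rewrite [RHS]mxE.
apply: (fun_mulmx ra) => k l.
  apply: (fun_mulmx ra) => {}k {}l.
    rewrite /row_factor; case: (a _); first exact: one.
    by apply: (fun_ext ra _ (regular_inv R G l k)) => x _; rewrite [RHS]mxE.
  exact/polynomial_regular/polynomial_snd.
by rewrite /column_factor; case: (b _); [apply: one|apply: regular_inv].
Qed.

(** The ancestors of y form a set Q such that no edge enters Q from outside, and
    [invmx_support] applies to I - Lam and Q. *)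
Lemma effects_reach (x : pairs) w y : Theta x ->
  effects x (rk w) (rk y) != 0 -> connect (obs_edge G) w y.
Proof.
case=> [[xs xu] _]; apply: contraNT => wy.
pose Q : pred 'I_d := fun i => connect (obs_edge G) (enum_val i) y.
apply/eqP/(invmx_support (Q := Q)) => //; rewrite /Q ?enum_rankK //.
move=> i j Qi Qj; rewrite !mxE.
have [ij|_] := eqVneq i j; first by rewrite ij Qj in Qi.
rewrite -(enum_valK i) -(enum_valK j) xs ?subr0 //.
by apply: contra Qi => /connect1/connect_trans; apply.
Qed.

Lemma effects_mul (x : pairs) : Theta x -> effects x *m (1%:M - x.1) = 1%:M.
Proof. by case=> [[_ u] _]; rewrite mulVmx. Qed.

Lemma row_factor_phi (x : pairs) : Theta x ->
  x.2 *m effects x = (1%:M - x.1)^T *m phi x.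
Proof.
move=> Tx; rewrite /phi -/(effects x) !mulmxA -trmx_mul effects_mul // trmx1.
by rewrite mul1mx.
Qed.

Lemma Om_support (Gam : 'M[R]_(#|L|, d)) W (H : {set L}) w z :
    RDLV G Gam -> diag_pos W -> w != z -> paL G w :&: paL G z \subset H ->
  tau Gam W (rk w) (rk z) = \sum_(h in H) Gam (rk h) (rk w) * Gam (rk h) (rk z).
Proof.
move=> Gs [Wd _] wz wzH; rewrite mxE (is_diag_mxP Wd) ?add0r; last first.
  by apply: contra wz => /eqP e; apply/eqP/enum_rank_inj/val_inj.
rewrite mxE sum_nodes [RHS]big_mkcond; apply: eq_bigr => h _; rewrite mxE.
case: ifPn => // hH; have [hw|hw] := boolP (lat_edge G h w); last first.
  by rewrite Gs ?mul0r.
rewrite (Gs h z) ?mulr0 //; apply: contra hH => hz.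
by apply: (subsetP wzH); rewrite !inE hw.
Qed.

Section Criterion.
Variables (v : V) (Y Z : {set V}) (H : {set L}).
Hypothesis htcYZ : [disjoint Y & v |: Z].
Hypothesis htcL : paLs G Y :&: paLs G (v |: Z) \subset H.

Definition in_htrs y : bool := `[< htrs G H (v |: Z) y >].

(** When y is not reachable, w ranges over its ancestors; if w were z, or shared
    with z a latent parent outside H, a half-trek avoiding H would lead from z
    to y through w. *)
Lemma row_factor_sep (x : pairs) y w z : Theta x -> y \in Y -> z \in v |: Z ->
    row_factor (in_htrs y) x (rk y) (rk w) != 0 ->
  w != z /\ paL G w :&: paL G z \subset H.
Proof.
move=> Tx yY zZ; have yz : z != y.
  by apply: contraTneq zZ => ->; rewrite (disjointFr htcYZ).
rewrite /row_factor; case: (boolP (in_htrs y)) => [_|/asboolPn nh].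
  rewrite mxE pnatr_eq0 eqb0 negbK (inj_eq enum_rank_inj) => /eqP<-.
  rewrite eq_sym yz; split=> //; apply: subset_trans htcL.
  by rewrite setISS // /paLs bigcup_sup.
rewrite mxE => /(effects_reach Tx)/connectP[p wp ye]; split.
  apply: contra_notN nh => /eqP wz; exists z => //; split => //.
  exists (Directed L w p); split=> // h _.
  rewrite /nodes /= !inE /=; apply/negP => /mapP[] //.
apply/subsetP => h; rewrite !inE => /andP[hw hz].
apply: contra_notT nh => hH; exists z => //; split => //.
exists (Latent z h w p); split=> //=; first by rewrite hz hw.
move=> k kH; have kh : k != h by apply: contraNneq hH => <-.
rewrite /nodes /= !inE /= (inj_eq (@inr_inj _ _)) (negPf kh) /=.
by apply/negP => /mapP[].
Qed.

Lemma row_factor_Om (x : pairs) Gam W y z :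
    Theta x -> RDLV G Gam -> diag_pos W -> x.2 = tau Gam W ->
    y \in Y -> z \in v |: Z ->
  (row_factor (in_htrs y) x *m x.2) (rk y) (rk z) =
  \sum_(h in H)
    (row_factor (in_htrs y) x *m Gam^T) (rk y) (rk h) * Gam (rk h) (rk z).
Proof.
move=> Tx Gs Wd xE yY zZ; rewrite mxE sum_nodes.
transitivity (\sum_w \sum_(h in H) row_factor (in_htrs y) x (rk y) (rk w) *
    (Gam (rk h) (rk w) * Gam (rk h) (rk z))).
  apply: eq_bigr => w _; rewrite -mulr_sumr.
  have [->|ne] := eqVneq (row_factor (in_htrs y) x (rk y) (rk w)) 0.
    by rewrite !mul0r.
  have [wz wzH] := row_factor_sep Tx yY zZ ne.
  by rewrite xE (Om_support Gs Wd wz wzH).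
rewrite exchange_big; apply: eq_bigr => h _ /=.
rewrite mxE sum_nodes mulr_suml; apply: eq_bigr => w _.
by rewrite [Gam^T _ _]mxE mulrA.
Qed.

Section System.
Variables (n : nat) (t : 'I_n -> halftrek V L).
Hypothesis tA : admissible G Y (Z :|: paV G v) Z H t.
Hypothesis ZP : [disjoint Z & paV G v].
Hypothesis ZH : #|Z| = #|H|.

Let y i := source (t i).
Let c j := target (t j).
Let M := coefficients t in_htrs (mem Z) : pairs -> 'M[R]_n.

Lemma source_mem i : y i \in Y.
Proof. by case: (adm_system tA) => _ _ _ <- _; apply: imset_f. Qed.

Lemma target_inj : injective c.
Proof. by case: (adm_system tA). Qed.

Lemma sum_targets (A : {set V}) (F : V -> R) : A \subset Z :|: paV G v ->
  \sum_(j | c j \in A) F (c j) = \sum_(u in A) F u.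
Proof.
move=> AB; rewrite [LHS](eq_bigl (fun j => j \in [pred j | c j \in A])) //.
rewrite -(big_imset _ (in2W target_inj)) /=; apply: eq_bigl => u.
apply/imsetP/idP => [[j jA ->]//|uA].
have : u \in [set target (t i) | i : 'I_n].
  by case: (adm_system tA) => _ _ _ _ ->; apply: (subsetP AB).
by case/imsetP => j _ uj; exists j; rewrite // inE /c -uj.
Qed.

(** Each target in Z uses its own node of H, and |Z| = |H|. *)
Lemma latent_of_Z h : h \in H -> exists2 j, c j \in Z & latent (t j) = Some h.
Proof.
pose g j := odflt h (latent (t j)).
pose A := [set j | c j \in Z].
have lA j : j \in A -> exists2 k, k \in H & latent (t j) = Some k.
  by rewrite inE => /(adm_Z tA)[b [k [_ kH ->]]]; exists k.
have gI : {in A &, injective g}.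
  move=> i j /lA[k _ ik] /lA[m _ jm]; rewrite /g ik jm /= => km.
  by apply: (latent_inj (adm_sided tA) ik); rewrite km.
have gH : g @: A \subset H.
  by apply/subsetP => _ /imsetP[j /lA[k kH jk] ->]; rewrite /g jk.
have cA : #|A| = #|Z|.
  have -> : Z = c @: A; last by rewrite card_imset //; apply: target_inj.
  apply/setP => z; apply/idP/imsetP => [zZ|[j]]; last by rewrite inE => ? ->.
  have : z \in [set target (t i) | i : 'I_n].
    by case: (adm_system tA) => _ _ _ _ ->; rewrite inE zZ.
  by case/imsetP => j _ zj; exists j; rewrite // inE /c -zj.
have gE : g @: A = H.
  by apply/eqP; rewrite eqEcard gH (card_in_imset gI) cA ZH leqnn.
rewrite -{1}gE => /imsetP[j jA hj]; exists j; first by rewrite inE in jA.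
by have [k _ jk] := lA j jA; rewrite hj /g jk.
Qed.

Lemma coefficients_Z (x : pairs) i j : c j \in Z ->
  M x i j = (row_factor (in_htrs (y i)) x *m x.2) (rk (y i)) (rk (c j)).
Proof. by move=> jZ; rewrite mxE /column_factor /= jZ mulmx1. Qed.

Lemma coefficients_pa (x : pairs) i j : c j \notin Z ->
  M x i j =
  (row_factor (in_htrs (y i)) x *m x.2 *m effects x) (rk (y i)) (rk (c j)).
Proof. by move=> jZ; rewrite mxE /column_factor /= (negPf jZ). Qed.

(** A vector killed by Gam_{H,Z} gives, extended by 0, a vector killed by M; so
    Gam_{H,Z} is invertible with M. *)
Lemma latent_solution (x : pairs) (Gam : 'M[R]_(#|L|, d)) W :
    Theta x -> RDLV G Gam -> diag_pos W -> x.2 = tau Gam W -> M x \in unitmx ->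
  exists psi : 'cV[R]_n, forall h, h \in H ->
    \sum_(j | c j \in Z) Gam (rk h) (rk (c j)) * psi j 0 = Gam (rk h) (rk v).
Proof.
move=> Tx Gs Wd xE Mu.
(* Gam_{H,Z} extended by an identity block, with H indexed by the half-treks
   ending in Z. *)
pose N : 'M[R]_n := \matrix_(i, j)
  if c i \in Z then
    if c j \in Z then
      if latent (t i) is Some h then Gam (rk h) (rk (c j)) else 0
    else 0
  else (i == j)%:R.
have NE (u : 'cV[R]_n) h i : c i \in Z -> latent (t i) = Some h ->
    (N *m u) i 0 = \sum_(j | c j \in Z) Gam (rk h) (rk (c j)) * u j 0.
  move=> iZ ih; rewrite mxE [RHS]big_mkcond; apply: eq_bigr => j _.
  by rewrite mxE iZ ih; case: ifP => // _; rewrite mul0r.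
have Nu : N \in unitmx.
  apply: unitmx_ker => u Nu0.
  have u0 j : c j \notin Z -> u j 0 = 0.
    move=> jZ; have /colP/(_ j) := Nu0; rewrite !mxE (bigD1 j) //= big1.
      by rewrite mxE (negPf jZ) eqxx mul1r addr0.
    by move=> k kj; rewrite mxE (negPf jZ) eq_sym (negPf kj) mul0r.
  suff Mu0 : M x *m u = 0 by rewrite -[u]mul1mx -(mulVmx Mu) -mulmxA Mu0 mulmx0.
  apply/colP => i; rewrite !mxE.
  transitivity (\sum_(j | c j \in Z) \sum_(h in H)
     (row_factor (in_htrs (y i)) x *m Gam^T) (rk (y i)) (rk h) *
       (Gam (rk h) (rk (c j)) * u j 0)).
    rewrite [RHS]big_mkcond; apply: eq_bigr => j _; case: ifPn => jZ; last first.
      by rewrite u0 // mulr0.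
    rewrite coefficients_Z //.
    rewrite (row_factor_Om Tx Gs Wd xE (source_mem i)) ?inE ?jZ ?orbT //.
    by rewrite mulr_suml; apply: eq_bigr => h _; rewrite mulrA.
  rewrite exchange_big big1 //= => h hH; rewrite -mulr_sumr.
  have [k kZ kh] := latent_of_Z hH.
  by rewrite -(NE _ _ _ kZ kh) Nu0 [X in _ * X]mxE mulr0.
pose g : 'cV[R]_n := \col_i if latent (t i) is Some h then Gam (rk h) (rk v) else 0.
exists (invmx N *m g) => h hH; have [k kZ kh] := latent_of_Z hH.
by rewrite -(NE _ _ _ kZ kh) mulmxA mulmxV // mul1mx mxE kh.
Qed.

Definition rhs (x : pairs) : 'cV[R]_n :=
  \col_i (row_factor (in_htrs (y i)) x *m x.2 *m effects x) (rk (y i)) (rk v).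

Lemma linear_system (x : pairs) : Theta x -> M x \in unitmx ->
  exists2 w : 'cV[R]_n, M x *m w = rhs x &
    forall j, c j \notin Z -> w j 0 = x.1 (rk (c j)) (rk v).
Proof.
move=> Tx Mu; have [[xs _] [Gam [W [Gs Wd xE]]]] := Tx.
have [psi psiE] := latent_solution Tx Gs Wd xE Mu.
exists (\col_j if c j \in Z then psi j 0 else x.1 (rk (c j)) (rk v)); last first.
  by move=> j jZ; rewrite mxE (negPf jZ).
apply/colP => i; rewrite [RHS]mxE mxE (bigID (fun j => c j \in Z)) /=.
set S := row_factor (in_htrs (y i)) x.
have -> : \sum_(j | c j \in Z) M x i j * (\col_j if c j \in Z then psi j 0
    else x.1 (rk (c j)) (rk v)) j 0 = (S *m x.2) (rk (y i)) (rk v).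
  rewrite (row_factor_Om Tx Gs Wd xE (source_mem i)) ?inE ?eqxx // -/S.
  transitivity (\sum_(j | c j \in Z) \sum_(h in H)
     (S *m Gam^T) (rk (y i)) (rk h) * (Gam (rk h) (rk (c j)) * psi j 0)).
    apply: eq_bigr => j jZ; rewrite mxE jZ coefficients_Z //.
    rewrite (row_factor_Om Tx Gs Wd xE (source_mem i)) ?inE ?jZ ?orbT //.
    by rewrite mulr_suml; apply: eq_bigr => h _; rewrite mulrA.
  rewrite exchange_big /=; apply: eq_bigr => h hH.
  by rewrite -mulr_sumr psiE.
have -> : \sum_(j | c j \notin Z) M x i j * (\col_j if c j \in Z then psi j 0
    else x.1 (rk (c j)) (rk v)) j 0 =
    (S *m x.2 *m effects x *m x.1) (rk (y i)) (rk v).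
  rewrite [RHS]mxE sum_nodes [RHS](bigID (mem (paV G v))) /=.
  rewrite [X in _ + X]big1 ?addr0 => [|u]; last first.
    by rewrite inE => uv; rewrite xs ?mulr0.
  rewrite -sum_targets ?subsetUr //.
  have cP j : (c j \notin Z) = (c j \in paV G v).
    have : c j \in Z :|: paV G v.
      by case: (adm_system tA) => _ _ _ _ <-; apply: imset_f.
    rewrite inE; case: (boolP (c j \in Z)) => [jZ _|//].
    by rewrite (disjointFr ZP jZ).
  rewrite (eq_bigl _ _ cP); apply: eq_bigr => j.
  by rewrite -cP => jZ; rewrite coefficients_pa // mxE (negPf jZ).
have {1}-> : S *m x.2 = S *m x.2 *m effects x *m (1%:M - x.1).
  by rewrite -[RHS]mulmxA effects_mul // mulmx1.
by rewrite mulmxBr mulmx1 mxE [(- _ : 'M_d) _ _]mxE subrK.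
Qed.

Hypothesis Theta_inh : exists x, Theta x.

Lemma identifiable_into z :
    (forall u, obs_edge G u z -> rationally_identifiable R G u z) ->
  forall u, identifiable G (fun x : pairs => (1%:M - x.1) (rk u) (rk z)).
Proof.
have ia := identifiable_algebra Theta_inh => idz u.
have cst := fun_cst ia.
apply: (fun_ext ia (f := fun x : pairs => (rk u == rk z)%:R - x.1 (rk u) (rk z))).
  by move=> x _; rewrite !mxE.
apply: (fun_sub ia) => //; have [uz|uz] := boolP (obs_edge G u z).
  exact/identifiable_edge/idz.
by apply: (fun_ext ia _ (cst 0)) => x [[xs _] _]; rewrite xs.
Qed.

Hypothesis identZY : forall u z : V, obs_edge G u z ->
  z \in Z \/ (z \in Y /\ htrs G H (v |: Z) z) -> rationally_identifiable R G u z.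

(** For reachable y this is row y of (I - Lam)^T S, which involves the edges into
    y; otherwise it is a row of S. *)
Lemma identifiable_row i u : identifiable G (fun x : pairs =>
  (row_factor (in_htrs (y i)) x *m x.2 *m effects x) (rk (y i)) (rk u)).
Proof.
have ia := identifiable_algebra Theta_inh.
rewrite /row_factor; case: (boolP (in_htrs (y i))) => [/asboolP hy|_]; last first.
  exact: (identifiable_phi Theta_inh).
apply: (fun_ext ia (f := fun x : pairs =>
  \sum_w (1%:M - x.1) (rk w) (rk (y i)) * phi x (rk w) (rk u))).
  move=> x Tx; rewrite mul1mx row_factor_phi // [RHS]mxE sum_nodes.
  by apply: eq_bigr => w _; rewrite [_^T _ _]mxE.
apply: (fun_sum ia) => w _; apply: (fun_mul ia).
  2: exact: (identifiable_phi Theta_inh).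
apply: identifiable_into => q qy; apply: identZY => //; right.
by split=> //; apply: source_mem.
Qed.

Lemma identifiable_coefficients i j : identifiable G (fun x : pairs => M x i j).
Proof.
have ia := identifiable_algebra Theta_inh.
have [jZ|jZ] := boolP (c j \in Z); last first.
  apply: (fun_ext ia _ (identifiable_row i (c j))) => x _.
  by rewrite coefficients_pa.
apply: (fun_ext ia (f := fun x : pairs => \sum_u
    (row_factor (in_htrs (y i)) x *m x.2 *m effects x) (rk (y i)) (rk u) *
    (1%:M - x.1) (rk u) (rk (c j)))).
  move=> x Tx; rewrite coefficients_Z // -[_ *m x.2 in RHS]mulmx1.
  by rewrite -[X in _ = (_ *m X) _ _](effects_mul Tx) mulmxA [RHS]mxE sum_nodes.
apply: (fun_sum ia) => u _; apply: (fun_mul ia); first exact: identifiable_row.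
by apply: identifiable_into => q qz; apply: identZY => //; left.
Qed.

(** Cramer's rule; the determinant is a regular function, so its zeros lie in a
    proper algebraic subset. *)
Lemma identifiable_target j :
    (exists2 x, Theta x & M x \in unitmx) -> c j \notin Z ->
  identifiable G (fun x : pairs => x.1 (rk (c j)) (rk v)).
Proof.
move=> [x0 Tx0 Mx0] jZ; have ia := identifiable_algebra Theta_inh.
apply: (@identifiable_div _ _ _ _ (fun x => (\adj (M x) *m rhs x) j 0)
  (fun x => \det (M x))).
- apply: (fun_ext ia (f := fun x => \sum_i \adj (M x) j i * rhs x i 0)) => [x _|].
    by rewrite [RHS]mxE.
  apply: (fun_sum ia) => i _; apply: (fun_mul ia).
    by apply: (fun_adj ia) => k m; apply: identifiable_coefficients.
  apply: (fun_ext ia _ (identifiable_row i v)) => x _.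
  by rewrite [RHS]mxE.
- by apply: (fun_det ia (A := M)) => k m; apply: identifiable_coefficients.
- apply: (fun_det (regular_algebra R G) (A := M)) => k m.
  exact: regular_coefficients.
- by exists x0 => //; move: Mx0; rewrite unitmxE unitfE.
- move=> x Tx Mx; have [|w <- wE] := linear_system Tx.
    by rewrite unitmxE unitfE.
  by rewrite mulmxA mul_adj_mx mul_scalar_mx mxE wE // mulrC.
Qed.

End System.
End Criterion.
End Equations.

Theorem theorem3p7 (R : realType) (V L : finType) (G : lf_graph V L)
    (v : V) (Y Z : {set V}) (H : {set L})
    (vNY : v \notin Y) (vNZ : v \notin Z)
    (htc : lf_htc G v Y Z H)
    (identZY : forall u y : V, obs_edge G u y ->
       y \in Z \/ (y \in Y /\ htrs G H (v |: Z) y) ->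
       rationally_identifiable R G u y) :
  forall u : V, obs_edge G u v -> rationally_identifiable R G u v.
Proof.
case: htc => [[_ ZH ZP] [YZ YZL] [n [t0 [t0S t0N t0Z]]]] u uv.
have YZ' : [disjoint Y & Z] by apply: disjointWr YZ; apply: subsetUr.
have [t [tA tU tC]] := admissible_untangled YZ' (Admissible t0S t0N t0Z).
have Tx := Theta_x0 R tA tU.
have Mx := coefficients_x0_unit R tA tU tC (in_htrs G v Z H).
have uP : u \in paV G v by rewrite inE.
have : u \in [set target (t i) | i : 'I_n].
  by case: (adm_system tA) => _ _ _ _ ->; rewrite inE uP orbT.
case/imsetP => j _ uj; apply/identifiable_edge; rewrite uj.
apply: (identifiable_target YZ YZL tA ZP ZH _ identZY).
- by exists (x0 R t).
- by exists (x0 R t).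
- by rewrite -uj (disjointFl ZP uP).
Qed.
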